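(* Let $Q, A_1,A_2,A_3,A_4,B_1,B_2,B_3,B_4\in\mathbb{R}$ satisfy $A_1+B_3+Q=A_3+B_1$ and $A_2+B_4=A_4+B_2$. Let $(\mathfrak{y}_m,Y_m)_{m\in\mathbb{Z}}$ and $(\mathfrak{z}_m,Z_m)_{m\in\mathbb{Z}}$ be sequences with $\mathfrak{y}_m,\mathfrak{z}_m\in\{+1,-1\}$ and $Y_m,Z_m\in\mathbb{R}$ which satisfy the ultradiscrete Riccati-type equation with parity variables, i.e. for all $m\in\mathbb{Z}$ both $$\max\big[mQ+A_2+B_4,\ Z_{m+1}+A_4+S(-\mathfrak{z}_{m+1}),\ Y_m+B_4+S(-\mathfrak{y}_m),\ Y_m+Z_{m+1}+S(\mathfrak{y}_m\mathfrak{z}_{m+1})\big]$$ $$=\max\big[Z_{m+1}+A_4+S(\mathfrak{z}_{m+1}),\ Y_m+B_4+S(\mathfrak{y}_m),\ Y_m+Z_{m+1}+S(-\mathfrak{y}_m\mathfrak{z}_{m+1})\big]$$ and $$\max\big[mQ+A_3+B_1,\ Y_{m+1}+B_3+S(-\mathfrak{y}_{m+1}),\ Z_{m+1}+A_3+S(-\mathfrak{z}_{m+1}),\ Y_{m+1}+Z_{m+1}+S(\mathfrak{y}_{m+1}\mathfrak{z}_{m+1})\big]$$ $$=\max\big[Z_{m+1}+A_3+S(\mathfrak{z}_{m+1}),\ Y_{m+1}+B_3+S(\mathfrak{y}_{m+1}),\ Y_{m+1}+Z_{m+1}+S(-\mathfrak{y}_{m+1}\mathfrak{z}_{m+1})\big].$$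 Then these sequences satisfy the ultradiscrete Painlevé VI equation with parity variables, i.e. for all $m\in\mathbb{Z}$ both $$\max\big[\max(A_1,A_2)+mQ+Y_m+B_3+B_4+S(\mathfrak{y}_m),\ \max(2Y_m,A_3+A_4)+Z_m+Z_{m+1}+S(\mathfrak{z}_m\mathfrak{z}_{m+1}),$$ $$\max(A_3,A_4)+Y_m+Z_m+Z_{m+1}+S(-\mathfrak{y}_m\mathfrak{z}_m\mathfrak{z}_{m+1})\big]$$ $$=\max\big[\max(2mQ+A_1+A_2,2Y_m)+B_3+B_4,\ \max(A_1,A_2)+mQ+Y_m+B_3+B_4+S(-\mathfrak{y}_m),$$ $$\max(2Y_m,A_3+A_4)+Z_m+Z_{m+1}+S(-\mathfrak{z}_m\mathfrak{z}_{m+1}),\ \max(A_3,A_4)+Y_m+Z_m+Z_{m+1}+S(\mathfrak{y}_m\mathfrak{z}_m\mathfrak{z}_{m+1})\big]$$ and $$\max\big[\max(B_1,B_2)+mQ+Z_{m+1}+A_3+A_4+S(\mathfrak{z}_{m+1}),\ \max(2Z_{m+1},B_3+B_4)+Y_m+Y_{m+1}+S(\mathfrak{y}_m\mathfrak{y}_{m+1}),$$ $$\max(B_3,B_4)+Y_m+Y_{m+1}+Z_{m+1}+S(-\mathfrak{y}_m\mathfrak{y}_{m+1}\mathfrak{z}_{m+1})\big]$$ $$=\max\big[\max(2mQ+B_1+B_2,2Z_{m+1})+A_3+A_4,\ \max(B_1,B_2)+mQ+Z_{m+1}+A_3+A_4+S(-\mathfrak{z}_{m+1}),$$ $$\max(2Z_{m+1},B_3+B_4)+Y_m+Y_{m+1}+S(-\mathfrak{y}_m\mathfrak{y}_{m+1}),\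 \max(B_3,B_4)+Y_m+Y_{m+1}+Z_{m+1}+S(\mathfrak{y}_m\mathfrak{y}_{m+1}\mathfrak{z}_{m+1})\big].$$
   Context: The parity function $S:\{+1,-1\}\to\{0,-\infty\}$ is defined by $S(+1)=0$ and $S(-1)=-\infty$. Terms containing $S(-1)=-\infty$ are ignored in the maxima; that is, the equations are read in $\mathbb{R}\cup\{-\infty\}$ with $x+(-\infty)=-\infty$, and a maximum all of whose terms are $-\infty$ equals $-\infty$ (so an equation in which one side is $-\infty$ and the other contains a real term is not satisfied). The ultradiscrete Painlevé VI equation is considered with the parameter constraint $B_1+B_2+A_3+A_4=Q+A_1+A_2+B_3+B_4$, which is the sum of the two parameter conditions assumed in the statement. *)

(* Defs.v *)
From HB Require Import structures.
From mathcomp Require Import all_boot all_order all_algebra.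
From mathcomp Require Import reals constructive_ereal.

Set Implicit Arguments.
Unset Strict Implicit.
Unset Printing Implicit Defensive.

Import Order.TTheory GRing.Theory Num.Theory.

Local Open Scope ring_scope.
Local Open Scope ereal_scope.

(* The equations live in R U {-oo}, rendered inside \bar R; +oo never occurs
   in them, since each term is a real number plus at most one value of the
   parity function. *)

(* Only the values at 1 and -1 are meaningful. *)
Definition parityS {R : realType} (s : int) : \bar R :=
  if s == 1%R then 0 else -oo.

Definition emax (R : realType) (s : seq (\bar R)) : \bar R :=
  \big[maxe/-oo]_(x <- s) x.

Definition is_parity (y : int -> int) : Prop :=
  forall m : int, (y m = 1 \/ y m = -1)%R.

Definition udRiccati (R : realType) (Q A2 A3 A4 B1 B3 B4 : R)
    (y : int -> int) (Y : int -> R) (z : int -> int) (Z : int -> R) : Prop :=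
  forall m : int,
    emax [:: (m%:~R * Q + A2 + B4)%R%:E;
             (Z (m + 1) + A4)%R%:E + parityS (- z (m + 1))%R;
             (Y m + B4)%R%:E + parityS (- y m)%R;
             (Y m + Z (m + 1))%R%:E + parityS (y m * z (m + 1))%R]
    = emax [:: (Z (m + 1) + A4)%R%:E + parityS (z (m + 1))%R;
               (Y m + B4)%R%:E + parityS (y m);
               (Y m + Z (m + 1))%R%:E + parityS (- (y m * z (m + 1)))%R]
  /\
    emax [:: (m%:~R * Q + A3 + B1)%R%:E;
             (Y (m + 1) + B3)%R%:E + parityS (- y (m + 1))%R;
             (Z (m + 1) + A3)%R%:E + parityS (- z (m + 1))%R;
             (Y (m + 1) + Z (m + 1))%R%:E + parityS (y (m + 1) * z (m + 1))%R]
    = emax [:: (Z (m + 1) + A3)%R%:E + parityS (z (m + 1))%R;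
               (Y (m + 1) + B3)%R%:E + parityS (y (m + 1))%R;
               (Y (m + 1) + Z (m + 1))%R%:E
                 + parityS (- (y (m + 1) * z (m + 1)))%R].

Definition udPVI (R : realType) (Q A1 A2 A3 A4 B1 B2 B3 B4 : R)
    (y : int -> int) (Y : int -> R) (z : int -> int) (Z : int -> R) : Prop :=
  forall m : int,
    emax [:: (Num.max A1 A2 + m%:~R * Q + Y m + B3 + B4)%R%:E + parityS (y m);
             (Num.max (2 * Y m) (A3 + A4) + Z m + Z (m + 1))%R%:E
               + parityS (z m * z (m + 1))%R;
             (Num.max A3 A4 + Y m + Z m + Z (m + 1))%R%:E
               + parityS (- (y m * z m * z (m + 1)))%R]
    = emax [:: (Num.max (2 * m%:~R * Q + A1 + A2) (2 * Y m) + B3 + B4)%R%:E;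
               (Num.max A1 A2 + m%:~R * Q + Y m + B3 + B4)%R%:E
                 + parityS (- y m)%R;
               (Num.max (2 * Y m) (A3 + A4) + Z m + Z (m + 1))%R%:E
                 + parityS (- (z m * z (m + 1)))%R;
               (Num.max A3 A4 + Y m + Z m + Z (m + 1))%R%:E
                 + parityS (y m * z m * z (m + 1))%R]
  /\
    emax [:: (Num.max B1 B2 + m%:~R * Q + Z (m + 1) + A3 + A4)%R%:E
               + parityS (z (m + 1))%R;
             (Num.max (2 * Z (m + 1)) (B3 + B4) + Y m + Y (m + 1))%R%:E
               + parityS (y m * y (m + 1))%R;
             (Num.max B3 B4 + Y m + Y (m + 1) + Z (m + 1))%R%:E
               + parityS (- (y m * y (m + 1) * z (m + 1)))%R]
    = emax [:: (Num.max (2 * m%:~R * Q + B1 + B2) (2 * Z (m + 1))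
                 + A3 + A4)%R%:E;
               (Num.max B1 B2 + m%:~R * Q + Z (m + 1) + A3 + A4)%R%:E
                 + parityS (- z (m + 1))%R;
               (Num.max (2 * Z (m + 1)) (B3 + B4) + Y m + Y (m + 1))%R%:E
                 + parityS (- (y m * y (m + 1)))%R;
               (Num.max B3 B4 + Y m + Y (m + 1) + Z (m + 1))%R%:E
                 + parityS (y m * y (m + 1) * z (m + 1))%R].

(* Main.v *)
Require Import Defs.
From mathcomp Require Import all_boot all_order all_algebra.
From mathcomp Require Import reals constructive_ereal.
From mathcomp Require Import ring lra.

Import Order.TTheory GRing.Theory Num.Theory.

Local Open Scope ring_scope.

(* Signed real numbers (s, u) with the tropical addition form the hyperfield of
   signed tropical numbers, in which x - y is the single element of larger
   absolute value when x != y, and the set of all (s, u) with u <= x when x = y.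
   Each Riccati equation says that two products Z (Y - a) and b (Y - c) have a
   common element.  Multiplying the common elements of the two Riccati
   equations that share Y gives a common element of
   Z Z' (Y^2 - (A3 + A4) Y + A3 A4) and
   B3 B4 (Y^2 - (A1 + A2) T Y + A1 A2 T^2), where T stands for m Q; that such
   an element exists is the Painleve equation.  The second Painleve equation is
   the first one with the roles of (A, Y) and (B, Z) exchanged. *)

(* (s, u) belongs to the hyperdifference of the positive elements x and y;
   s = true is the sign +1. *)
Definition in_hyperdiff {R : realType} (s : bool) (x y u : R) : Prop :=
  if s then x = Num.max y u else y = Num.max x u.

Lemma in_hyperdiffN (R : realType) s (x y u : R) :
  in_hyperdiff (~~ s) x y u = in_hyperdiff s y x u.
Proof. by case: s. Qed.

(** For positive signs, substitution turns both sides into the maximum of the same four sums;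
    negating the sign of a factor exchanges its two terms. *)
Lemma in_hyperdiffM {R : realType} {s t} {x y x' y' u v : R} :
  in_hyperdiff s x y u -> in_hyperdiff t x' y' v ->
  in_hyperdiff (s == t) (Num.max (x + x') (y + y'))
    (Num.max (x + y') (y + x')) (u + v).
Proof.
have pos a b a' b' : a = Num.max b u -> a' = Num.max b' v ->
    Num.max (a + a') (b + b') = Num.max (Num.max (a + b') (b + a')) (u + v).
  move=> -> ->; rewrite !addr_maxl !addr_maxr; apply/le_anti/andP.
  by split; rewrite !(ge_max, le_max) !lexx ?orbT.
case: s; case: t => /= hs ht.
- exact: pos.
- exact: pos.
- by rewrite ![Num.max (x + _) _]maxC; exact: pos.
- by rewrite ![Num.max (x + _) _]maxC; exact: pos.
Qed.

(* The hypothesis says that 0 belongs to p - q - (r - v). *)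
Lemma hyperdiff_meet (R : realType) (p q r v : R) :
  Num.max v p = Num.max q r ->
  exists s u, in_hyperdiff s p q u /\ in_hyperdiff s r v u.
Proof.
case: (ltgtP p q) => [pq|qp|<-] h.
- exists false, q; split=> /=; first by rewrite max_r // ltW.
  move: h; do 3?case: leP => ?; lra.
- exists true, p; split=> /=; first by rewrite max_r // ltW.
  move: h; do 3?case: leP => ?; lra.
(* Since [p = q], [p - q] contains everything of size at most [p]: the larger of [r] and [v], cut
   off at [p], serves. *)
- case: (leP v r) => vr.
    exists true, (Num.min p r); move: h => /=; case: (leP p r) => pr h.
      by rewrite maxxx h.
    by rewrite max_l ?max_r // ltW.
  exists false, (Num.min p v); move: h => /=; case: (leP p v) => pv h.
    by rewrite maxxx maxC h.
  by rewrite max_l ?max_r // ltW.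
Qed.

(** Converse to [hyperdiff_meet]: both sides reduce to one maximum of [u] and the two smaller
    terms. *)
Lemma hyperdiff_balance (R : realType) s (x y x' y' u : R) :
  in_hyperdiff s x y u -> in_hyperdiff s x' y' u ->
  Num.max y' x = Num.max x' y.
Proof. by case: s => /= -> ->; [rewrite maxCA maxC | rewrite maxC maxCA]. Qed.

Lemma addr_max (R : realType) (x y x' y' : R) :
  Num.max x y + Num.max x' y' =
  Num.max (Num.max (x + x') (y + y')) (Num.max (x + y') (y + x')).
Proof.
rewrite !addr_maxl !addr_maxr; apply/le_anti/andP.
by split; rewrite !(ge_max, le_max) !lexx ?orbT.
Qed.

Lemma parityS1 (R : realType) : parityS 1 = 0%E :> \bar R.
Proof. by []. Qed.

Lemma parityS_N1 (R : realType) : parityS (- 1) = -oo%E :> \bar R.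
Proof. by []. Qed.

Definition emaxE (R : realType) :=
  (@mulN1r int, @mulrN1 int, @mul1r int, @mulr1 int, @opprK int,
   @parityS1 R, @parityS_N1 R, @adde0 R, @addeNy R, @maxeNy R, @maxNye R,
   =^~ @EFin_max R, @big_cons (\bar R), @big_nil (\bar R)).

Section Riccati.

Variable R : realType.
Implicit Types (a b c t Y Z W : R) (y z w : int).

(** For signed [Y] and [Z]: 0 belongs to [c - a Z - b Y + Y Z]. *)
Definition riccati c a b y z Y Z : Prop :=
  emax [:: c%:E; (Z + a)%:E + parityS (- z); (Y + b)%:E + parityS (- y);
           (Y + Z)%:E + parityS (y * z)]%E
  = emax [:: (Z + a)%:E + parityS z; (Y + b)%:E + parityS y;
             (Y + Z)%:E + parityS (- (y * z))]%E.

Lemma riccatiC c a b y z Y Z : riccati c a b y z Y Z = riccati c b a z y Z Y.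
Proof.
rewrite /riccati /emax !(big_cons, big_nil) [z * y]mulrC [Z + Y]addrC.
by congr (maxe _ _ = _); rewrite maxCA.
Qed.

Lemma riccati_pos {c a b z Y Z} : z = 1 \/ z = - 1 ->
  riccati (c + b) a b 1 z Y Z ->
  exists s u, in_hyperdiff (s == (z == 1)) (Z + Y) (Z + a) u
           /\ in_hyperdiff s (b + Y) (b + c) u.
Proof.
rewrite /riccati /emax [Z + Y]addrC [b + Y]addrC [b + c]addrC.
move=> [] ->; rewrite !emaxE => -[].
  by move=> /hyperdiff_meet[s [u [hp hr]]]; exists s, u; rewrite eqb_id.
rewrite [RHS]maxC => /hyperdiff_meet[s [u [hp hr]]].
by exists s, u; rewrite eqbF_neg in_hyperdiffN.
Qed.

(** For negative [Y] nothing cancels in [Y - a] and [Y - c]; if [z] were also -1, the right side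
    would be -oo. *)
Lemma riccati_neg {c a b z Y Z} : z = 1 \/ z = - 1 ->
  riccati (c + b) a b (-1) z Y Z ->
  z = 1 /\ Num.max Y c + b = Z + Num.max Y a.
Proof.
rewrite /riccati /emax addr_maxl addr_maxr => -[] ->; rewrite !emaxE => // -[] h.
by rewrite maxC h maxC [Y + Z]addrC.
Qed.

Lemma riccati_painleve t a1 a2 a3 a4 b3 b4 y z w Y Z W :
  y = 1 \/ y = - 1 -> z = 1 \/ z = - 1 -> w = 1 \/ w = - 1 ->
  riccati (t + a1 + b3) a3 b3 y z Y Z ->
  riccati (t + a2 + b4) a4 b4 y w Y W ->
  emax [:: (Num.max a1 a2 + t + Y + b3 + b4)%:E + parityS y;
           (Num.max (2 * Y) (a3 + a4) + Z + W)%:E + parityS (z * w);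
           (Num.max a3 a4 + Y + Z + W)%:E + parityS (- (y * z * w))]%E
  = emax [:: (Num.max (2 * t + a1 + a2) (2 * Y) + b3 + b4)%:E;
             (Num.max a1 a2 + t + Y + b3 + b4)%:E + parityS (- y);
             (Num.max (2 * Y) (a3 + a4) + Z + W)%:E + parityS (- (z * w));
             (Num.max a3 a4 + Y + Z + W)%:E + parityS (y * z * w)]%E.
Proof.
move=> hy hz hw.
(* The four coefficients are put in the expanded form that [in_hyperdiffM] produces. *)
have -> : Num.max (2 * Y) (a3 + a4) + Z + W =
    Num.max ((Z + Y) + (W + Y)) ((Z + a3) + (W + a4)).
  by rewrite !addr_maxl; congr Num.max; ring.
have -> : Num.max a3 a4 + Y + Z + W =
    Num.max ((Z + Y) + (W + a4)) ((Z + a3) + (W + Y)).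
  by rewrite maxC !addr_maxl; congr Num.max; ring.
have -> : Num.max (2 * t + a1 + a2) (2 * Y) + b3 + b4 =
    Num.max ((b3 + Y) + (b4 + Y)) ((b3 + (t + a1)) + (b4 + (t + a2))).
  by rewrite maxC !addr_maxl; congr Num.max; ring.
have -> : Num.max a1 a2 + t + Y + b3 + b4 =
    Num.max ((b3 + Y) + (b4 + (t + a2))) ((b3 + (t + a1)) + (b4 + Y)).
  by rewrite maxC !addr_maxl; congr Num.max; ring.
case: hy => ->.
  move=> /(riccati_pos hz)[s [u [Pu Qu]]].
  move=> /(riccati_pos hw)[s' [v [Pv Qv]]].
  have P := in_hyperdiffM Pu Pv; have Q := in_hyperdiffM Qu Qv.
  rewrite /emax; case: hz hw P {Pu Pv Qu Qv} => -> [] -> P; rewrite !emaxE;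
    by congr EFin; case: s s' P Q => -[] P Q; apply: hyperdiff_balance _ Q.
(* For [y = -1] the equation is the product of two equalities of reals. *)
move=> /(riccati_neg hz)[-> h] /(riccati_neg hw)[-> h'].
rewrite /emax !emaxE -!addr_max -!addr_maxr -h -h'; congr EFin.
by ring.
Qed.

End Riccati.

Theorem theorem1 (R : realType) (Q A1 A2 A3 A4 B1 B2 B3 B4 : R)
    (hAB13 : A1 + B3 + Q = A3 + B1) (hAB24 : A2 + B4 = A4 + B2)
    (y : int -> int) (Y : int -> R) (z : int -> int) (Z : int -> R)
    (hy : is_parity y) (hz : is_parity z)
    (hRiccati : udRiccati Q A2 A3 A4 B1 B3 B4 y Y z Z) :
  udPVI Q A1 A2 A3 A4 B1 B2 B3 B4 y Y z Z.
Proof.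
have first n : riccati R (n%:~R * Q + A2 + B4) A4 B4
    (y n) (z (n + 1)) (Y n) (Z (n + 1)) by have [] := hRiccati n.
have second n : riccati R (n%:~R * Q + A3 + B1) A3 B3
    (y (n + 1)) (z (n + 1)) (Y (n + 1)) (Z (n + 1)).
  have [_] := hRiccati n; rewrite /riccati /emax !(big_cons, big_nil).
  by rewrite [in LHS](maxCA (_ + parityS (- y _)))%E [in RHS]maxCA.
move=> m; split.
  rewrite -[2 * _ * Q]mulrA; apply: riccati_painleve => //.
  (* [Y m] and [Z m] meet in the second equation at [m - 1]; [hAB13] absorbs the shift by [Q]. *)
  have := second (m - 1); rewrite subrK.
  by have -> : (m - 1)%:~R * Q + A3 + B1 = m%:~R * Q + A1 + B3 by
    rewrite -addrA -hAB13 intrB; ring.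
(* [B1], [B3] go with [Y (m + 1)] and [B2], [B4] with [Y m], so [Y (m + 1)] must come first. *)
rewrite -[2 * _ * Q]mulrA [y m * y _]mulrC.
have -> : y (m + 1) * y m * z (m + 1) = z (m + 1) * y (m + 1) * y m by ring.
rewrite [_ + Y m + Y (m + 1)]addrAC.
have -> : Num.max B3 B4 + Y m + Y (m + 1) + Z (m + 1) =
    Num.max B3 B4 + Z (m + 1) + Y (m + 1) + Y m by ring.
apply: riccati_painleve => //; rewrite riccatiC.
  by have := second m; rewrite addrAC.
have := first m.
by rewrite -addrA hAB24 addrA addrAC.
Qed.
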